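(* Let $M$ and $N$ be Riemann surfaces with isothermal coordinates $z=x+iy$ on $M$ and $u=R+iS$ on $N$, and let $u=u(z,\bar z): M\to N$ be a (smooth) diffeomorphism which satisfies the Beltrami equation \[ \frac{u_{\bar z}}{u_z}=e^{-2\omega(z,\bar z)+i\phi(z,\bar z)}, \] where $\omega,\phi$ are smooth real-valued functions on $M$ and $\phi_{z\bar z}=0$ (that is, $\phi$ is harmonic). Let $\psi$ be the conjugate harmonic function to $\phi$, i.e. a real-valued function on $M$ such that $\psi+i\phi$ is holomorphic. Then $N$ can be equipped with a conformal metric $\tilde h=e^{\tilde F(u,\bar u)}|du|^2$ such that $u$ is a harmonic map and the Gauss curvature $\tilde K_N$ of $(N,\tilde h)$, evaluated at the point $u(z,\bar z)$, is \[ \tilde K_N=-\frac{2\,\omega_{z\bar z}}{\sinh 2\omega}\,e^{\psi}. \]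
   Context: Everything is expressed in isothermal coordinates: $z=x+iy$ on $M$ and $u=R+iS$ on $N$, so that maps $M\to N$ are written as complex-valued functions $u(z,\bar z)$ on a coordinate domain. Notation: $\partial_z=\frac12(\partial_x-i\partial_y)$, $\partial_{\bar z}=\frac12(\partial_x+i\partial_y)$; subscripts denote partial derivatives. If $N$ carries the conformal metric $h=e^{F(u,\bar u)}|du|^2$ ($F$ real-valued), a map $u:M\to N$ is called harmonic if \[ u_{z\bar z}+F_u(u,\bar u)\,u_z\,u_{\bar z}=0 . \] This depends only on the conformal structure of $M$. The Gauss curvature of $h$ is $K_N=-2F_{u\bar u}e^{-F}$. The Jacobian of a diffeomorphism is nowhere vanishing, i.e. $|u_z|^2\neq|u_{\bar z}|^2$ everywhere. *)

(* Defs.v *)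
(* Stdlib reals and Coquelicot.  Surfaces are read in a global isothermal
   coordinate, so M and N are domains of the complex plane; functions on them
   are total functions whose values outside the domain are irrelevant. *)
From Stdlib Require Import Reals.
From Coquelicot Require Import Coquelicot.

Open Scope R_scope.

Definition plane_domain (D : C -> Prop) : Prop :=
  open D /\
  (exists z, D z) /\
  forall U V : C -> Prop, open U -> open V ->
    (forall z, D z -> U z \/ V z) ->
    (exists z, D z /\ U z) -> (exists z, D z /\ V z) ->
    exists z, D z /\ U z /\ V z.

(* On an open set, [ex_diff_n] for all n at every point says that all iterated
   partial derivatives exist and are continuous. *)
Definition smoothR (D : C -> Prop) (f : C -> R) : Prop :=
  forall z, D z ->
  forall n : nat, ex_diff_n (fun x y => f (x, y)) n (Re z) (Im z).

Definition smoothC (D : C -> Prop) (f : C -> C) : Prop :=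
  smoothR D (fun z => Re (f z)) /\ smoothR D (fun z => Im (f z)).

Definition diffeomorphism (M N : C -> Prop) (u : C -> C) : Prop :=
  smoothC M u /\ (forall z, M z -> N (u z)) /\
  exists v : C -> C,
    smoothC N v /\ (forall w, N w -> M (v w)) /\
    (forall z, M z -> v (u z) = z) /\ (forall w, N w -> u (v w) = w).

Definition d_x (f : C -> C) (z : C) : C :=
  (Derive (fun t => Re (f (t, Im z))) (Re z),
   Derive (fun t => Im (f (t, Im z))) (Re z)).

Definition d_y (f : C -> C) (z : C) : C :=
  (Derive (fun t => Re (f (Re z, t))) (Im z),
   Derive (fun t => Im (f (Re z, t))) (Im z)).

Definition d_z (f : C -> C) (z : C) : C :=
  (/ 2 * (d_x f z - Ci * d_y f z))%C.

Definition d_zbar (f : C -> C) (z : C) : C :=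
  (/ 2 * (d_x f z + Ci * d_y f z))%C.

Definition d_z_zbar (f : C -> C) : C -> C := d_zbar (d_z f).

Definition toC (f : C -> R) : C -> C := fun z => RtoC (f z).

Definition Cexp (z : C) : C :=
  (exp (Re z) * cos (Im z), exp (Re z) * sin (Im z)).

Definition holomorphic (D : C -> Prop) (f : C -> C) : Prop :=
  forall z, D z -> @ex_derive C_AbsRing C_NormedModule f z.

(* Since a / 0 = 0 in [C] and [Cexp] never vanishes, this forces u_z <> 0. *)
Definition beltrami (M : C -> Prop) (u : C -> C) (omega phi : C -> R) : Prop :=
  forall z, M z ->
    (d_zbar u z / d_z u z)%C =
    Cexp (RtoC (- 2 * omega z) + Ci * RtoC (phi z))%C.

(* [F] is the log-density of the conformal metric e^F |du|^2 on the target. *)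
Definition harmonic_map (M : C -> Prop) (F : C -> R) (u : C -> C) : Prop :=
  forall z, M z ->
    (d_z_zbar u z + d_z (toC F) (u z) * d_z u z * d_zbar u z)%C = RtoC 0.

(* Complex-valued only because Wirtinger derivatives are; it is real for
   smooth [F]. *)
Definition gauss_curvature (F : C -> R) (w : C) : C :=
  (- RtoC 2 * d_z_zbar (toC F) w * RtoC (exp (- F w)))%C.

(* Main.v *)
(* Put p = u_z, mu = e^sigma with sigma = -2 omega + i phi, so that
   u_zbar = mu p.  The Hopf differential e^F u_z conj(u_zbar) dz^2 of a harmonic
   map is holomorphic; prescribing it to be e^(-(psi + i phi)) dz^2 forces
     F o u = 2 omega - psi - ln |p|^2,
   and this is the log-density we take.  Differentiating it and using
   |mu| <> 1 (the Jacobian does not vanish) gives F_u p^2 = - (sigma_z p + p_z),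
   which is harmonicity since p_zbar = (mu p)_z = mu (sigma_z p + p_z).
   Differentiating the two expressions of F_u p^2 once more,
   (F_u)_zbar - mu (F_u)_z equals - sigma_zzbar / p = 2 omega_zzbar / p, while by
   the chain rule it equals F_{u ubar} conj(p) (1 - |mu|^2). *)

Require Import Defs.
From Stdlib Require Import Reals Lra Lia.
From Coquelicot Require Import Coquelicot.

(** * Real functions of class C^k on a plane domain *)

(** Total differentiability rather than mere existence of partial derivatives, since the chain rule
    requires it. *)
Definition grad (f : C -> R) (z : C) (a b : R) : Prop :=
  differentiable_pt_lim (fun x y => f (x, y)) (Re z) (Im z) a b.

Definition px (f : C -> R) (z : C) : R := Derive (fun t => f (t, Im z)) (Re z).
Definition py (f : C -> R) (z : C) : R := Derive (fun t => f (Re z, t)) (Im z).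

Definition Ck (D : C -> Prop) (n : nat) (f : C -> R) : Prop :=
  forall z, D z -> ex_diff_n (fun x y => f (x, y)) n (Re z) (Im z).

Lemma open_locally_2d (D : C -> Prop) (z : C) :
  open D -> D z -> locally_2d (fun x y => D (x, y)) (Re z) (Im z).
Proof.
intros oD Dz.
apply locally_2d_locally.
destruct z as [x y]; simpl.
generalize (oD (x, y) Dz); apply filter_imp.
now intros [a b].
Qed.

Lemma open_locally_2d_imp (D P : C -> Prop) (z : C) :
  open D -> D z -> (forall w, D w -> P w) ->
  locally_2d (fun x y => P (x, y)) (Re z) (Im z).
Proof.
intros oD Dz H.
destruct (open_locally_2d D z oD Dz) as [d Hd].
exists d; auto.
Qed.

Lemma grad_unique (f : C -> R) (z : C) (a b : R) :
  grad f z a b -> px f z = a /\ py f z = b.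
Proof. exact (differentiable_pt_lim_unique _ _ _ a b). Qed.

Lemma grad_ext_open (D : C -> Prop) (f g : C -> R) (z : C) (a b : R) :
  open D -> D z -> (forall w, D w -> f w = g w) -> grad f z a b -> grad g z a b.
Proof.
intros oD Dz H; apply differentiable_pt_lim_ext.
exact (open_locally_2d_imp D (fun w => f w = g w) z oD Dz H).
Qed.

Lemma grad_ex_derive (f : C -> R) (z : C) (a b : R) :
  grad f z a b ->
  ex_derive (fun t => f (t, Im z)) (Re z) /\ ex_derive (fun t => f (Re z, t)) (Im z).
Proof.
intros H; split.
- exists (a * 1 + b * 0).
  apply is_derive_Reals, (derivable_pt_lim_comp_2d (fun x y => f (x, y))
    (fun t => t) (fun _ => Im z)); [exact H | apply derivable_pt_lim_id | apply derivable_pt_lim_const].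
- exists (a * 0 + b * 1).
  apply is_derive_Reals, (derivable_pt_lim_comp_2d (fun x y => f (x, y))
    (fun _ => Re z) (fun t => t)); [exact H | apply derivable_pt_lim_const | apply derivable_pt_lim_id].
Qed.

Lemma grad_continuity (f : C -> R) (z : C) (a b : R) :
  grad f z a b -> continuity_2d_pt (fun x y => f (x, y)) (Re z) (Im z).
Proof. intros H; apply differentiable_continuity_pt; now exists a, b. Qed.

Lemma Ck_ext (D : C -> Prop) (n : nat) (f g : C -> R) :
  open D -> (forall w, D w -> f w = g w) -> Ck D n f -> Ck D n g.
Proof.
intros oD H Hf z Dz; generalize (Hf z Dz); apply ex_diff_n_ext_loc.
exact (open_locally_2d_imp D (fun w => f w = g w) z oD Dz H).
Qed.

Lemma Ck_le (D : C -> Prop) (n m : nat) (f : C -> R) :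
  (m <= n)%nat -> Ck D n f -> Ck D m f.
Proof. intros H Hf z Dz; exact (ex_diff_n_m n m H _ _ _ (Hf z Dz)). Qed.

Lemma Ck_continuity (D : C -> Prop) (n : nat) (f : C -> R) (z : C) :
  Ck D n f -> D z -> continuity_2d_pt (fun x y => f (x, y)) (Re z) (Im z).
Proof. intros H Dz; destruct n; apply (H z Dz). Qed.

(** The step of the inductions on n below. The given components agree with [px f] and [py f] only on
    D, so regularity is moved to the latter by extensionality on the open set. *)
Lemma Ck_intro (D : C -> Prop) (n : nat) (f a b : C -> R) :
  open D -> (forall z, D z -> grad f z (a z) (b z)) ->
  Ck D n a -> Ck D n b -> Ck D (S n) f.
Proof.
intros oD H Ha Hb.
assert (Hx : Ck D n (px f)).
{ apply (Ck_ext D n a); trivial.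
  intros w Dw; symmetry; apply (grad_unique f w (a w) (b w)); auto. }
assert (Hy : Ck D n (py f)).
{ apply (Ck_ext D n b); trivial.
  intros w Dw; symmetry; apply (grad_unique f w (a w) (b w)); auto. }
intros z Dz.
split; [exact (grad_continuity _ _ _ _ (H z Dz)) |].
destruct (grad_ex_derive _ _ _ _ (H z Dz)) as [H1 H2].
split; [exact H1 | split; [exact H2 | split]].
- exact (Hx z Dz).
- exact (Hy z Dz).
Qed.

Lemma Ck_partials (D : C -> Prop) (n : nat) (f : C -> R) :
  Ck D (S n) f -> Ck D n (px f) /\ Ck D n (py f).
Proof.
intros H; split; intros z Dz.
- exact (ex_diff_n_deriv_aux1 _ _ _ _ (H z Dz)).
- exact (ex_diff_n_deriv_aux2 _ _ _ _ (H z Dz)).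
Qed.

(** By the classical criterion: the x-derivative exists near z and is continuous at z, and the
    y-derivative exists at z. *)
Lemma Ck_grad (D : C -> Prop) (n : nat) (f : C -> R) (z : C) :
  open D -> Ck D (S n) f -> D z -> grad f z (px f z) (py f z).
Proof.
intros oD H Dz.
apply filterdiff_differentiable_pt_lim.
apply (is_derive_filterdiff (fun x y => f (x, y)) (Re z) (Im z) (fun x y => px f (x, y))).
- apply (locally_2d_locally (fun x y => is_derive (fun t => f (t, y)) x (px f (x, y)))).
  apply (open_locally_2d_imp D (fun w => is_derive (fun t => f (t, Im w)) (Re w) (px f w)) z oD Dz).
  intros w Dw; apply Derive_correct, (H w Dw).
- apply Derive_correct, (H z Dz).
- destruct (Ck_partials _ _ _ H) as [Hx _].
  apply (proj1 (continuity_2d_pt_filterlim (fun x y => px f (x, y)) (Re z) (Im z))).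
  exact (Ck_continuity D n (px f) z Hx Dz).
Qed.

(** * Differentiation rules for gradients *)

Lemma differentiable_pt_lim_affine (g : R -> R -> R) (x y a b : R) :
  (forall u v, g u v = g x y + (a * (u - x) + b * (v - y))) ->
  differentiable_pt_lim g x y a b.
Proof.
intros H eps; exists eps; intros u v _ _.
rewrite H; replace (_ - _) with 0 by ring; rewrite Rabs_R0.
apply Rmult_le_pos; [apply Rlt_le, cond_pos |].
apply Rle_trans with (Rabs (u - x)); [apply Rabs_pos | apply Rmax_l].
Qed.

Lemma differentiable_pt_lim_mult (x y : R) :
  differentiable_pt_lim (fun u v => u * v) x y y x.
Proof.
intros eps; exists eps; intros u v Hu Hv.
(* The remainder of the product is exactly (u - x)(v - y), so delta = eps works. *)
replace (_ - _) with ((u - x) * (v - y)) by ring; rewrite Rabs_mult.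
apply Rmult_le_compat; try apply Rabs_pos; [now apply Rlt_le | apply Rmax_r].
Qed.

Lemma grad_comp_2d (g : R -> R -> R) (f1 f2 : C -> R) (z : C) (l1 l2 a b c d : R) :
  differentiable_pt_lim g (f1 z) (f2 z) l1 l2 -> grad f1 z a b -> grad f2 z c d ->
  grad (fun w => g (f1 w) (f2 w)) z (l1 * a + l2 * c) (l1 * b + l2 * d).
Proof.
intros Hg H1 H2; destruct z as [x y].
exact (differentiable_pt_lim_comp g (fun x y => f1 (x, y)) (fun x y => f2 (x, y))
  x y l1 l2 a b c d Hg H1 H2).
Qed.

Lemma grad_comp_1d (g : R -> R) (f : C -> R) (z : C) (l a b : R) :
  is_derive g (f z) l -> grad f z a b -> grad (fun w => g (f w)) z (l * a) (l * b).
Proof.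
intros Hg H.
(* [g] is viewed as a function of two variables that is constant in the second, which creates the
   zero terms. *)
replace (l * a) with (l * a + 0 * a) by ring.
replace (l * b) with (l * b + 0 * b) by ring.
apply (grad_comp_2d (fun x _ => g x) f f); trivial.
now apply differentiable_pt_lim_proj1_0, is_derive_Reals.
Qed.

Lemma grad_eq (f : C -> R) (z : C) (a b a' b' : R) :
  grad f z a b -> a = a' -> b = b' -> grad f z a' b'.
Proof. now intros H <- <-. Qed.

Lemma grad_plus (f g : C -> R) (z : C) (a b c d : R) :
  grad f z a b -> grad g z c d -> grad (fun w => f w + g w) z (a + c) (b + d).
Proof.
intros Hf Hg; eapply grad_eq.
- apply (fun H => grad_comp_2d Rplus _ _ _ 1 1 _ _ _ _ H Hf Hg).
  apply differentiable_pt_lim_affine; intros; ring.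
- ring.
- ring.
Qed.

Lemma grad_mult (f g : C -> R) (z : C) (a b c d : R) :
  grad f z a b -> grad g z c d ->
  grad (fun w => f w * g w) z (a * g z + f z * c) (b * g z + f z * d).
Proof.
intros Hf Hg; eapply grad_eq.
- apply (grad_comp_2d Rmult _ _ _ _ _ _ _ _ _ (differentiable_pt_lim_mult _ _) Hf Hg).
- ring.
- ring.
Qed.

Lemma grad_const (c : R) (z : C) : grad (fun _ => c) z 0 0.
Proof. apply differentiable_pt_lim_affine; intros; ring. Qed.

Lemma grad_minus (f g : C -> R) (z : C) (a b c d : R) :
  grad f z a b -> grad g z c d -> grad (fun w => f w - g w) z (a - c) (b - d).
Proof.
intros Hf Hg; apply (grad_comp_1d Ropp g z (-1)) in Hg.
- eapply grad_eq; [apply (grad_plus _ _ _ _ _ _ _ Hf Hg) | ring | ring].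
- auto_derive; [trivial | ring].
Qed.

(** * Closure of the classes C^k under algebra, logarithm and composition *)

Lemma Ck_const (D : C -> Prop) (n : nat) (c : R) : open D -> Ck D n (fun _ => c).
Proof.
intros oD; revert c; induction n as [|n IH]; intros c.
- intros z _; split; [apply continuity_2d_pt_const | trivial].
- apply (Ck_intro D n _ (fun _ => 0) (fun _ => 0)); auto using grad_const.
Qed.

Lemma Ck_plus (D : C -> Prop) (n : nat) (f g : C -> R) :
  open D -> Ck D n f -> Ck D n g -> Ck D n (fun z => f z + g z).
Proof.
intros oD; revert f g; induction n as [|n IH]; intros f g Hf Hg.
- intros z Dz; split; [|trivial].
  apply continuity_2d_pt_plus; [apply (Hf z Dz) | apply (Hg z Dz)].
- destruct (Ck_partials _ _ _ Hf), (Ck_partials _ _ _ Hg).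
  apply (Ck_intro D n _ (fun z => px f z + px g z) (fun z => py f z + py g z)); auto.
  intros z Dz; apply grad_plus; eauto using Ck_grad.
Qed.

Lemma Ck_mult (D : C -> Prop) (n : nat) (f g : C -> R) :
  open D -> Ck D n f -> Ck D n g -> Ck D n (fun z => f z * g z).
Proof.
intros oD; revert f g; induction n as [|n IH]; intros f g Hf Hg.
- intros z Dz; split; [|trivial].
  apply continuity_2d_pt_mult; [apply (Hf z Dz) | apply (Hg z Dz)].
- destruct (Ck_partials _ _ _ Hf), (Ck_partials _ _ _ Hg).
  assert (Ck D n f /\ Ck D n g) as [? ?].
  { split; apply (Ck_le D (S n)); auto. }
  apply (Ck_intro D n _ (fun z => px f z * g z + f z * px g z)
                        (fun z => py f z * g z + f z * py g z)); auto using Ck_plus.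
  intros z Dz; apply grad_mult; eauto using Ck_grad.
Qed.

(** The gradient of 1/f is -(1/f)^2 times that of f, so the induction hypothesis for 1/f itself
    closes the induction. *)
Lemma Ck_inv (D : C -> Prop) (n : nat) (f : C -> R) :
  open D -> (forall z, D z -> f z <> 0) -> Ck D n f -> Ck D n (fun z => / f z).
Proof.
intros oD f0; induction n as [|n IH]; intros Hf.
- intros z Dz; split; [|trivial].
  apply continuity_2d_pt_inv; [apply (Hf z Dz) | apply (f0 (_, _)); now destruct z].
- destruct (Ck_partials _ _ _ Hf).
  assert (Hi : Ck D n (fun z => / f z)) by (apply IH, (Ck_le D (S n)); auto).
  assert (Hl : Ck D n (fun z => -1 * (/ f z * / f z)))
    by auto using Ck_mult, Ck_const.
  apply (Ck_intro D n _ (fun z => -1 * (/ f z * / f z) * px f z)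
                        (fun z => -1 * (/ f z * / f z) * py f z)); auto using Ck_mult.
  intros z Dz; apply grad_comp_1d; eauto using Ck_grad.
  auto_derive; [auto | field; auto].
Qed.

Lemma Ck_ln (D : C -> Prop) (n : nat) (f : C -> R) :
  open D -> (forall z, D z -> 0 < f z) -> Ck D n f -> Ck D n (fun z => ln (f z)).
Proof.
intros oD f0 Hf; destruct n as [|n].
- intros z Dz; split; [|trivial].
  apply (continuity_1d_2d_pt_comp ln); [| apply (Hf z Dz)].
  apply derivable_continuous_pt; exists (/ f z).
  destruct z as [x y]; apply derivable_pt_lim_ln; exact (f0 _ Dz).
- destruct (Ck_partials _ _ _ Hf).
  assert (Hi : Ck D n (fun z => / f z)).
  { apply Ck_inv; trivial; [|apply (Ck_le D (S n)); auto].
    intros z Dz; specialize (f0 z Dz); lra. }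
  apply (Ck_intro D n _ (fun z => / f z * px f z) (fun z => / f z * py f z));
    auto using Ck_mult.
  intros z Dz; apply grad_comp_1d; eauto using Ck_grad.
  now apply is_derive_ln, f0.
Qed.

Lemma grad_comp (f f1 f2 : C -> R) (z : C) (l1 l2 a b c d : R) :
  grad f (f1 z, f2 z) l1 l2 -> grad f1 z a b -> grad f2 z c d ->
  grad (fun w => f (f1 w, f2 w)) z (l1 * a + l2 * c) (l1 * b + l2 * d).
Proof. exact (grad_comp_2d (fun x y => f (x, y)) f1 f2 z l1 l2 a b c d). Qed.

Lemma Ck_comp (D E : C -> Prop) (n : nat) (f f1 f2 : C -> R) :
  open D -> open E -> (forall z, D z -> E (f1 z, f2 z)) ->
  Ck E n f -> Ck D n f1 -> Ck D n f2 -> Ck D n (fun z => f (f1 z, f2 z)).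
Proof.
(* [f] is generalized because the induction hypothesis is applied to its partial derivatives. *)
intros oD oE DE; revert f; induction n as [|n IH]; intros f Hf H1 H2.
- intros z Dz; split; [|trivial]; intros eps.
  destruct z as [x y]; simpl.
  destruct (Hf _ (DE _ Dz)) as [Cf _].
  destruct (Cf eps) as [d Hd].
  destruct (H1 _ Dz) as [C1 _]; destruct (C1 d) as [d1 Hd1].
  destruct (H2 _ Dz) as [C2 _]; destruct (C2 d) as [d2 Hd2].
  exists (mkposreal _ (Rmin_stable_in_posreal d1 d2)); simpl in *.
  intros u v Hu Hv; apply Hd; [apply Hd1 | apply Hd2];
    eauto using Rlt_le_trans, Rmin_l, Rmin_r.
- destruct (Ck_partials _ _ _ Hf), (Ck_partials _ _ _ H1), (Ck_partials _ _ _ H2).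
  assert (Ck D n f1 /\ Ck D n f2) as [? ?] by (split; apply (Ck_le D (S n)); auto).
  apply (Ck_intro D n _
    (fun z => px f (f1 z, f2 z) * px f1 z + py f (f1 z, f2 z) * px f2 z)
    (fun z => px f (f1 z, f2 z) * py f1 z + py f (f1 z, f2 z) * py f2 z));
    auto using Ck_plus, Ck_mult.
  intros z Dz; apply grad_comp; eauto using Ck_grad.
Qed.

Lemma Ck_schwarz (D : C -> Prop) (f : C -> R) (z : C) :
  open D -> Ck D 2 f -> D z -> px (py f) z = py (px f) z.
Proof.
intros oD H Dz.
destruct (Ck_partials _ _ _ H) as [Hx Hy].
destruct (Ck_partials _ _ _ Hx) as [_ Hxy].
destruct (Ck_partials _ _ _ Hy) as [Hyx _].
apply (Schwarz (fun x y => f (x, y)) (Re z) (Im z)).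
- destruct (open_locally_2d D z oD Dz) as [d Hd].
  exists d; intros u v Hu Hv; specialize (Hd u v Hu Hv).
  destruct (H _ Hd) as (_ & E1 & E2 & _).
  destruct (Hy _ Hd) as (_ & E3 & _ & _).
  destruct (Hx _ Hd) as (_ & _ & E4 & _).
  split; [exact E1 | split; [exact E2 | split; [exact E3 | exact E4]]].
- exact (Ck_continuity _ _ _ _ Hyx Dz).
- exact (Ck_continuity _ _ _ _ Hxy Dz).
Qed.

(** * Wirtinger calculus *)

(* f_z = a and f_zbar = b at z, in the sense of real differentiability: the
   real gradient is recovered from f_x = a + b and f_y = i (a - b). *)
Definition wirt (f : C -> C) (z a b : C) : Prop :=
  grad (fun w => Re (f w)) z (Re a + Re b) (Im b - Im a) /\
  grad (fun w => Im (f w)) z (Im a + Im b) (Re a - Re b).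

Ltac C_components := apply injective_projections; simpl; unfold Re, Im in *; simpl.

Lemma wirt_unique (f : C -> C) (z a b : C) :
  wirt f z a b -> d_z f z = a /\ d_zbar f z = b.
Proof.
intros [H1 H2].
apply grad_unique in H1; apply grad_unique in H2.
unfold px, py in H1, H2; destruct H1 as [H1 H1'], H2 as [H2 H2'].
unfold d_z, d_zbar, d_x, d_y; rewrite H1, H2, H1', H2'.
split; C_components; field.
Qed.

Lemma wirt_ext_open (D : C -> Prop) (f g : C -> C) (z a b : C) :
  open D -> D z -> (forall w, D w -> f w = g w) -> wirt f z a b -> wirt g z a b.
Proof.
intros oD Dz H [H1 H2]; split.
- apply (grad_ext_open D (fun w => Re (f w))); trivial; intros w Dw; now rewrite H.
- apply (grad_ext_open D (fun w => Im (f w))); trivial; intros w Dw; now rewrite H.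
Qed.

(** Used to differentiate an identity that holds on an open set: compute both sides by the rules,
    then equate the results. *)
Lemma wirt_agree (D : C -> Prop) (f g : C -> C) (z a b c d : C) :
  open D -> D z -> (forall w, D w -> f w = g w) ->
  wirt f z a b -> wirt g z c d -> a = c /\ b = d.
Proof.
intros oD Dz H Hf Hg.
apply (wirt_ext_open D f g) in Hf; trivial.
apply wirt_unique in Hf; apply wirt_unique in Hg.
destruct Hf as [<- <-], Hg as [<- <-]; auto.
Qed.

Lemma wirt_plus (f g : C -> C) (z a b c d : C) :
  wirt f z a b -> wirt g z c d -> wirt (fun w => f w + g w)%C z (a + c)%C (b + d)%C.
Proof.
intros [F1 F2] [G1 G2]; split; eapply grad_eq.
- exact (grad_plus _ _ _ _ _ _ _ F1 G1).
- unfold Re, Im; simpl; ring.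
- unfold Re, Im; simpl; ring.
- exact (grad_plus _ _ _ _ _ _ _ F2 G2).
- unfold Re, Im; simpl; ring.
- unfold Re, Im; simpl; ring.
Qed.

Lemma wirt_mult (f g : C -> C) (z a b c d : C) :
  wirt f z a b -> wirt g z c d ->
  wirt (fun w => f w * g w)%C z (a * g z + f z * c)%C (b * g z + f z * d)%C.
Proof.
intros [F1 F2] [G1 G2]; split; eapply grad_eq.
- exact (grad_minus _ _ _ _ _ _ _ (grad_mult _ _ _ _ _ _ _ F1 G1)
                                   (grad_mult _ _ _ _ _ _ _ F2 G2)).
- unfold Re, Im; simpl; ring.
- unfold Re, Im; simpl; ring.
- exact (grad_plus _ _ _ _ _ _ _ (grad_mult _ _ _ _ _ _ _ F1 G2)
                                  (grad_mult _ _ _ _ _ _ _ F2 G1)).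
- unfold Re, Im; simpl; ring.
- unfold Re, Im; simpl; ring.
Qed.

Lemma wirt_const (c z : C) : wirt (fun _ => c) z 0 0.
Proof.
split; (eapply grad_eq; [apply grad_const | unfold Re, Im; simpl; ring..]).
Qed.

Lemma wirt_scal (c : C) (f : C -> C) (z a b : C) :
  wirt f z a b -> wirt (fun w => c * f w)%C z (c * a)%C (c * b)%C.
Proof.
intros H.
replace (c * a)%C with (0 * f z + c * a)%C by ring.
replace (c * b)%C with (0 * f z + c * b)%C by ring.
apply (wirt_mult (fun _ => c)); trivial using wirt_const.
Qed.

Lemma wirt_conj (f : C -> C) (z a b : C) :
  wirt f z a b -> wirt (fun w => Cconj (f w)) z (Cconj b) (Cconj a).
Proof.
intros [F1 F2]; split; eapply grad_eq.
- exact F1.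
- simpl; unfold Re, Im; simpl; ring.
- simpl; unfold Re, Im; simpl; ring.
- apply (grad_comp_1d Ropp (fun w => Im (f w)) z (-1)); [| exact F2].
  auto_derive; [trivial | ring].
- simpl; unfold Re, Im; simpl; ring.
- simpl; unfold Re, Im; simpl; ring.
Qed.

(** The conjugate of u has z-derivative conj(u_zbar) and zbar-derivative conj(u_z); these multiply
    the zbar-derivative of f. *)
Lemma wirt_comp (f u : C -> C) (z a b c d : C) :
  wirt f (u z) a b -> wirt u z c d ->
  wirt (fun w => f (u w)) z (a * c + b * Cconj d)%C (a * d + b * Cconj c)%C.
Proof.
intros [F1 F2] [U1 U2].
assert (E : forall w, u w = (Re (u w), Im (u w))) by (intros w; now destruct (u w)).
rewrite E in F1, F2.
apply (fun H => grad_comp (fun w => Re (f w)) _ _ z _ _ _ _ _ _ H U1 U2) in F1.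
apply (fun H => grad_comp (fun w => Im (f w)) _ _ z _ _ _ _ _ _ H U1 U2) in F2.
split.
- apply (grad_ext_open (fun _ => True) (fun w => Re (f (Re (u w), Im (u w)))));
    [apply open_true | trivial | intros w _; now rewrite <- E |].
  eapply grad_eq; [exact F1 | |]; unfold Re, Im; simpl; ring.
- apply (grad_ext_open (fun _ => True) (fun w => Im (f (Re (u w), Im (u w)))));
    [apply open_true | trivial | intros w _; now rewrite <- E |].
  eapply grad_eq; [exact F2 | |]; unfold Re, Im; simpl; ring.
Qed.

Lemma wirt_id (z : C) : wirt (fun w => w) z 1 0.
Proof. split; apply differentiable_pt_lim_affine; intros; simpl; ring. Qed.

Lemma wirt_Cexp (f : C -> C) (z a b : C) :
  wirt f z a b -> wirt (fun w => Cexp (f w)) z (Cexp (f z) * a)%C (Cexp (f z) * b)%C.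
Proof.
intros [F1 F2].
pose proof (grad_comp_1d exp _ _ _ _ _ (is_derive_exp _) F1) as E.
pose proof (grad_comp_1d cos _ _ _ _ _ (is_derive_cos _) F2) as Co.
pose proof (grad_comp_1d sin _ _ _ _ _ (is_derive_sin _) F2) as Si.
split; eapply grad_eq.
- exact (grad_mult _ _ _ _ _ _ _ E Co).
- unfold Cexp, Re, Im; simpl; ring.
- unfold Cexp, Re, Im; simpl; ring.
- exact (grad_mult _ _ _ _ _ _ _ E Si).
- unfold Cexp, Re, Im; simpl; ring.
- unfold Cexp, Re, Im; simpl; ring.
Qed.

Lemma wirt_toC (f : C -> R) (z : C) (a b : R) :
  grad f z a b -> wirt (toC f) z (a / 2, - b / 2) (a / 2, b / 2).
Proof.
intros H; split; (eapply grad_eq; [first [exact H | exact (grad_const 0 z)] | |]);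
  unfold Re, Im; simpl; field.
Qed.

(** The imaginary part of [toC f] is constantly zero; its vanishing gradient forces b = conj a. *)
Lemma wirt_toC_grad (f : C -> R) (z a b : C) :
  wirt (toC f) z a b -> grad f z (Re a + Re b) (Im b - Im a) /\ b = Cconj a.
Proof.
intros [H H0]; split; [exact H |].
apply grad_unique in H0.
destruct (grad_unique _ _ _ _ (grad_const 0 z)) as [E1 E2].
change (fun w => Im (toC f w)) with (fun _ : C => 0) in H0.
rewrite E1, E2 in H0; unfold Re, Im in H0.
C_components; lra.
Qed.

(** * Smooth functions and their Wirtinger derivatives *)

Lemma smoothR_Ck (D : C -> Prop) (f : C -> R) :
  smoothR D f <-> forall n, Ck D n f.
Proof. unfold smoothR, Ck; split; auto. Qed.

Lemma smoothR_const (D : C -> Prop) (c : R) : open D -> smoothR D (fun _ => c).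
Proof. intros oD; apply smoothR_Ck; auto using Ck_const. Qed.

Lemma smoothR_plus (D : C -> Prop) (f g : C -> R) :
  open D -> smoothR D f -> smoothR D g -> smoothR D (fun z => f z + g z).
Proof. rewrite !smoothR_Ck; auto using Ck_plus. Qed.

Lemma smoothR_mult (D : C -> Prop) (f g : C -> R) :
  open D -> smoothR D f -> smoothR D g -> smoothR D (fun z => f z * g z).
Proof. rewrite !smoothR_Ck; auto using Ck_mult. Qed.

Lemma smoothR_minus (D : C -> Prop) (f g : C -> R) :
  open D -> smoothR D f -> smoothR D g -> smoothR D (fun z => f z - g z).
Proof.
intros oD Hf Hg.
apply smoothR_Ck; intros n.
apply (Ck_ext D n (fun z => f z + -1 * g z)); [trivial | intros; ring |].
apply smoothR_Ck; auto using smoothR_plus, smoothR_mult, smoothR_const.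
Qed.

Lemma smoothR_ln (D : C -> Prop) (f : C -> R) :
  open D -> (forall z, D z -> 0 < f z) -> smoothR D f -> smoothR D (fun z => ln (f z)).
Proof. rewrite !smoothR_Ck; auto using Ck_ln. Qed.

Lemma smoothR_partials (D : C -> Prop) (f : C -> R) :
  smoothR D f -> smoothR D (px f) /\ smoothR D (py f).
Proof. rewrite !smoothR_Ck; intros H; split; intros n; apply (Ck_partials D n f (H _)). Qed.

Lemma smoothR_grad (D : C -> Prop) (f : C -> R) (z : C) :
  open D -> smoothR D f -> D z -> grad f z (px f z) (py f z).
Proof. rewrite smoothR_Ck; intros oD H; now apply (Ck_grad D 0). Qed.

(** Serves for a function known only through its gradient, such as the conjugate harmonic
    function. *)
Lemma smoothR_intro (D : C -> Prop) (f a b : C -> R) :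
  open D -> (forall z, D z -> grad f z (a z) (b z)) ->
  smoothR D a -> smoothR D b -> smoothR D f.
Proof.
rewrite !smoothR_Ck; intros oD H Ha Hb n.
apply (Ck_le D (S n)); [lia |].
now apply (Ck_intro D n f a b).
Qed.

Lemma smoothR_comp (D E : C -> Prop) (f : C -> R) (u : C -> C) :
  open D -> open E -> (forall z, D z -> E (u z)) ->
  smoothR E f -> smoothC D u -> smoothR D (fun z => f (u z)).
Proof.
intros oD oE DE Hf [H1 H2]; apply smoothR_Ck; intros n.
assert (P : forall z, (Re (u z), Im (u z)) = u z) by (intros z; now destruct (u z)).
apply (Ck_ext D n (fun z => f (Re (u z), Im (u z)))); trivial.
- intros w _; now rewrite P.
- rewrite smoothR_Ck in Hf, H1, H2.
  apply (Ck_comp D E); auto.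
  intros z Dz; rewrite P; auto.
Qed.

Lemma smoothC_toC (D : C -> Prop) (f : C -> R) :
  open D -> smoothR D f -> smoothC D (toC f).
Proof. intros oD H; split; [exact H | exact (smoothR_const D 0 oD)]. Qed.

Lemma smoothC_const (D : C -> Prop) (c : C) : open D -> smoothC D (fun _ => c).
Proof. intros oD; split; now apply smoothR_const. Qed.

Lemma smoothC_plus (D : C -> Prop) (f g : C -> C) :
  open D -> smoothC D f -> smoothC D g -> smoothC D (fun z => f z + g z)%C.
Proof.
intros oD [F1 F2] [G1 G2]; split; [exact (smoothR_plus D _ _ oD F1 G1) | exact (smoothR_plus D _ _ oD F2 G2)].
Qed.

Lemma smoothC_mult (D : C -> Prop) (f g : C -> C) :
  open D -> smoothC D f -> smoothC D g -> smoothC D (fun z => f z * g z)%C.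
Proof.
intros oD [F1 F2] [G1 G2]; split.
- apply smoothR_minus; trivial; now apply smoothR_mult.
- apply smoothR_plus; trivial; now apply smoothR_mult.
Qed.

Lemma smoothC_d_x (D : C -> Prop) (f : C -> C) : smoothC D f -> smoothC D (d_x f).
Proof.
intros [H1 H2].
split; [apply (smoothR_partials _ _ H1) | apply (smoothR_partials _ _ H2)].
Qed.

Lemma smoothC_d_y (D : C -> Prop) (f : C -> C) : smoothC D f -> smoothC D (d_y f).
Proof.
intros [H1 H2].
split; [apply (smoothR_partials _ _ H1) | apply (smoothR_partials _ _ H2)].
Qed.

Lemma smoothC_d_z (D : C -> Prop) (f : C -> C) :
  open D -> smoothC D f -> smoothC D (d_z f).
Proof.
intros oD H; unfold d_z, Cminus.
apply smoothC_mult; [trivial | now apply smoothC_const |].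
apply smoothC_plus; [trivial | now apply smoothC_d_x |].
assert (Hs : smoothC D (fun z => - Ci * d_y f z)%C).
{ apply smoothC_mult; trivial; [now apply smoothC_const | now apply smoothC_d_y]. }
(* The two forms of the summand are equal but not convertible, so smoothness is transferred by
   extensionality. *)
assert (E : forall z, (- (Ci * d_y f z) = - Ci * d_y f z)%C) by (intros; ring).
split; [destruct Hs as [Hs _] | destruct Hs as [_ Hs]]; apply smoothR_Ck; intros n;
  (eapply Ck_ext; [exact oD | | apply smoothR_Ck; exact Hs]); intros w _; now rewrite E.
Qed.

Lemma smoothC_d_zbar (D : C -> Prop) (f : C -> C) :
  open D -> smoothC D f -> smoothC D (d_zbar f).
Proof.
intros oD H; unfold d_zbar.
auto 6 using smoothC_mult, smoothC_plus, smoothC_const, smoothC_d_x, smoothC_d_y.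
Qed.

Lemma smoothC_wirt (D : C -> Prop) (f : C -> C) (z : C) :
  open D -> smoothC D f -> D z -> wirt f z (d_z f z) (d_zbar f z).
Proof.
intros oD [H1 H2] Dz; split; (eapply grad_eq; [eapply smoothR_grad; eauto | |]);
  unfold px, py, d_z, d_zbar, d_x, d_y, Re, Im; simpl; field.
Qed.

(** The two expansions in second real derivatives differ only in the order of the mixed ones, which
    Schwarz's theorem exchanges. *)
Lemma d_z_d_zbar_comm (D : C -> Prop) (f : C -> C) (z : C) :
  open D -> smoothC D f -> D z -> d_z (d_zbar f) z = d_zbar (d_z f) z.
Proof.
intros oD H Dz.
pose proof (smoothC_wirt _ _ _ oD (smoothC_d_x _ _ H) Dz) as Hx.
pose proof (smoothC_wirt _ _ _ oD (smoothC_d_y _ _ H) Dz) as Hy.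
assert (E : d_x (d_y f) z = d_y (d_x f) z).
{ destruct H as [H1 H2]; rewrite smoothR_Ck in H1, H2.
  apply injective_projections;
    [exact (Ck_schwarz D _ z oD (H1 _) Dz) | exact (Ck_schwarz D _ z oD (H2 _) Dz)]. }
pose proof (wirt_scal (/ 2) _ _ _ _ (wirt_plus _ _ _ _ _ _ _ Hx (wirt_scal Ci _ _ _ _ Hy))) as A.
pose proof (wirt_scal (/ 2) _ _ _ _ (wirt_plus _ _ _ _ _ _ _ Hx (wirt_scal (- Ci) _ _ _ _ Hy))) as B.
apply (wirt_ext_open D _ (d_zbar f)) in A; [| trivial.. ].
apply (wirt_ext_open D _ (d_z f)) in B; [| trivial | trivial |
  intros w _; unfold d_z; ring].
apply wirt_unique in A; apply wirt_unique in B.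
rewrite (proj1 A), (proj2 B); unfold d_z, d_zbar; rewrite E; ring.
Qed.

(** * Conjugate harmonic functions *)

(** Compares the modulus, which measures complex derivatives, with the max norm of real
    differentiability. *)
Lemma Cmod_le_components (w : C) (m : R) :
  Rabs (Re w) <= m -> Rabs (Im w) <= m -> Cmod w <= 2 * m.
Proof.
intros H1 H2.
replace w with (RtoC (Re w) + Ci * RtoC (Im w))%C
  by (destruct w; apply injective_projections; unfold Re, Im; simpl; ring).
eapply Rle_trans; [apply Cmod_triangle |].
rewrite Cmod_mult, !Cmod_R.
replace (Cmod Ci) with 1; [lra |].
unfold Cmod, Ci; simpl; rewrite <- sqrt_1 at 1; f_equal; ring.
Qed.

(** The Cauchy-Riemann equations: the real and imaginary parts of the complex remainder are bounded
    by its modulus, so f is real differentiable with f_z = c and f_zbar = 0. *)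
Lemma ex_derive_wirt (f : C -> C) (z : C) :
  @ex_derive C_AbsRing C_NormedModule f z -> exists c, wirt f z c 0.
Proof.
intros [c [_ Hc]]; exists c.
specialize (Hc z (fun P H => H)).
assert (K : forall eps : posreal, locally_2d (fun x y =>
  Cmod (f (x, y) - f z - ((x, y) - z) * c)%C <=
  eps * Rmax (Rabs (x - Re z)) (Rabs (y - Im z))) (Re z) (Im z)).
{ intros eps.
  (* The modulus is at most twice the max norm m: eps/2 turns into eps on m, and m < d/4 keeps the
     point in the disc of radius d. *)
  destruct (Hc (pos_div_2 eps)) as [d Hd].
  exists (pos_div_2 (pos_div_2 d)); intros x y Hx Hy.
  set (m := Rmax (Rabs (x - Re z)) (Rabs (y - Im z))).
  assert (Hm : m < d / 2 / 2) by now apply Rmax_lub_lt.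
  assert (Hw : Cmod ((x, y) - z)%C <= 2 * m)
    by (apply Cmod_le_components; [apply Rmax_l | apply Rmax_r]).
  assert (d0 := cond_pos d).
  assert (Hb : Cmod ((x, y) - z)%C < d) by lra.
  specialize (Hd (x, y) Hb).
  eapply Rle_trans; [exact Hd |].
  change (eps / 2 * Cmod ((x, y) - z)%C <= eps * m).
  replace (eps * m) with (eps / 2 * (2 * m)) by field.
  apply Rmult_le_compat_l; [apply Rlt_le, (cond_pos (pos_div_2 eps)) | exact Hw]. }
assert (Q : forall w : C, Rabs (Re w) <= Cmod w /\ Rabs (Im w) <= Cmod w).
{ intros w; assert (H := Rmax_Cmod w).
  split; eapply Rle_trans; [apply Rmax_l | exact H | apply Rmax_r | exact H]. }
assert (Ez : z = (Re z, Im z)) by now destruct z.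
split; intros eps; destruct (K eps) as [d Hd]; exists d; intros x y Hx Hy;
  (eapply Rle_trans; [| exact (Hd x y Hx Hy)]);
  destruct (Q (f (x, y) - f z - ((x, y) - z) * c)%C) as [Q1 Q2];
  rewrite <- Ez.
- eapply Rle_trans; [right | exact Q1]; f_equal; unfold Re, Im; simpl; ring.
- eapply Rle_trans; [right | exact Q2]; f_equal; unfold Re, Im; simpl; ring.
Qed.

(** Cauchy-Riemann for psi + i phi: psi_x = phi_y and psi_y = - phi_x. *)
Lemma conjugate_harmonic_grad (phi psi : C -> R) (z : C) (a b : R) :
  @ex_derive C_AbsRing C_NormedModule
    (fun w => (RtoC (psi w) + Ci * RtoC (phi w))%C) z ->
  grad phi z a b -> grad psi z b (- a).
Proof.
intros H Hphi.
destruct (ex_derive_wirt _ _ H) as [c [H1 H2]].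
apply (grad_ext_open (fun _ => True) _ phi) in H2;
  [| apply open_true | trivial | intros w _; unfold Re, Im; simpl; ring].
apply (grad_ext_open (fun _ => True) _ psi) in H1;
  [| apply open_true | trivial | intros w _; unfold Re, Im; simpl; ring].
apply grad_unique in H2; apply grad_unique in Hphi.
destruct H2 as [E1 E2], Hphi as [E3 E4].
eapply grad_eq; [exact H1 | |]; rewrite <- ?E3, <- ?E4, ?E1, ?E2; simpl; ring.
Qed.

(** * The Beltrami equation and the metric *)

Lemma wirt_toC_comp_1d (g : R -> R) (f : C -> R) (z a b : C) (l : R) :
  is_derive g (f z) l -> wirt (toC f) z a b ->
  wirt (toC (fun w => g (f w))) z (RtoC l * a)%C (RtoC l * b)%C.
Proof.
intros Hg H; destruct (wirt_toC_grad _ _ _ _ H) as [Hf ->].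
split; (eapply grad_eq; [first [exact (grad_comp_1d g f z l _ _ Hg Hf) | exact (grad_const 0 z)] | |]);
  unfold Re, Im; simpl; ring.
Qed.

(** The squared modulus, kept polynomial so that its smoothness and its derivatives follow from the
    product rule. *)
Definition norm2 (w : C) : R := Re w * Re w + Im w * Im w.

Lemma norm2_Cconj (w : C) : RtoC (norm2 w) = (w * Cconj w)%C.
Proof. unfold norm2; C_components; ring. Qed.

Lemma norm2_pos (w : C) : w <> 0 -> 0 < norm2 w.
Proof.
intros H; unfold norm2.
assert (Re w <> 0 \/ Im w <> 0) as [E | E].
{ destruct (Req_dec (Re w) 0), (Req_dec (Im w) 0); auto.
  destruct H; now apply injective_projections. }
- apply Rplus_lt_le_0_compat; [now apply Rsqr_pos_lt | apply Rle_0_sqr].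
- apply Rplus_le_lt_0_compat; [apply Rle_0_sqr | now apply Rsqr_pos_lt].
Qed.

Lemma Cconj_neq_0 (w : C) : w <> 0 -> Cconj w <> 0.
Proof. intros H E; apply H; rewrite <- (Cconj_conj w), E; C_components; ring. Qed.

(** Formally ln |f|^2 = ln f + ln (conj f). No complex logarithm is used: the product f conj(f) is
    differentiated and divided by its value. *)
Lemma wirt_ln_norm2 (f : C -> C) (z a b : C) :
  f z <> 0 -> wirt f z a b ->
  wirt (toC (fun w => ln (norm2 (f w)))) z
    (a / f z + Cconj (b / f z))%C (b / f z + Cconj (a / f z))%C.
Proof.
intros f0 H.
assert (f0' := Cconj_neq_0 _ f0).
pose proof (wirt_mult _ _ _ _ _ _ _ H (wirt_conj _ _ _ _ H)) as HN.
apply (wirt_ext_open (fun _ => True) _ (toC (fun w => norm2 (f w)))) in HN;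
  [| apply open_true | trivial | intros w _; symmetry; apply norm2_Cconj].
apply (wirt_toC_comp_1d ln) with (l := / norm2 (f z)) in HN;
  [| now apply is_derive_ln, norm2_pos].
rewrite RtoC_inv, norm2_Cconj in HN by now apply Rgt_not_eq, norm2_pos.
replace (a / f z + Cconj (b / f z))%C
  with (/ (f z * Cconj (f z)) * (a * Cconj (f z) + f z * Cconj b))%C.
replace (b / f z + Cconj (a / f z))%C
  with (/ (f z * Cconj (f z)) * (b * Cconj (f z) + f z * Cconj a))%C.
- exact HN.
- unfold Cdiv; rewrite Cmult_conj, Cinv_conj by trivial; field; auto.
- unfold Cdiv; rewrite Cmult_conj, Cinv_conj by trivial; field; auto.
Qed.

Lemma Cexp_neq_0 (w : C) : Cexp w <> 0.
Proof.
intros E; apply (f_equal norm2) in E; revert E.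
replace (norm2 (Cexp w)) with (exp (Re w) * exp (Re w)).
- assert (H := exp_pos (Re w)).
  unfold norm2; simpl; intros E; nra.
- unfold norm2, Cexp; simpl.
  generalize (sin2_cos2 (Im w)); unfold Rsqr; intros E.
  transitivity (exp (Re w) * exp (Re w) * 1); [ring | rewrite <- E; ring].
Qed.

Lemma norm2_Cexp (w : C) : norm2 (Cexp w) = exp (2 * Re w).
Proof.
replace (2 * Re w) with (Re w + Re w) by ring; rewrite exp_plus.
unfold norm2, Cexp; simpl.
generalize (sin2_cos2 (Im w)); unfold Rsqr; intros E.
transitivity (exp (Re w) * exp (Re w) * 1); [rewrite <- E; ring | ring].
Qed.

(** The sigma of the outline: mu = [Cexp] sigma. *)
Definition beltrami_exponent (omega phi : C -> R) (z : C) : C :=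
  (RtoC (- 2 * omega z) + Ci * RtoC (phi z))%C.

Lemma wirt_beltrami_exponent (omega phi : C -> R) (z a b c d : C) :
  wirt (toC omega) z a b -> wirt (toC phi) z c d ->
  wirt (beltrami_exponent omega phi) z (- (2) * a + Ci * c)%C (- (2) * b + Ci * d)%C.
Proof.
intros Ho Hp.
apply (wirt_ext_open (fun _ => True) (fun w => (- (2) * toC omega w) + Ci * toC phi w)%C).
- apply open_true.
- trivial.
- intros w _; unfold beltrami_exponent, toC; C_components; ring.
- now apply wirt_plus; apply wirt_scal.
Qed.

Lemma beltrami_coefficient (M : C -> Prop) (u : C -> C) (omega phi : C -> R) (z : C) :
  beltrami M u omega phi -> M z ->
  d_z u z <> 0 /\ d_zbar u z = (Cexp (beltrami_exponent omega phi z) * d_z u z)%C.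
Proof.
intros H Mz; specialize (H z Mz).
change (d_zbar u z / d_z u z = Cexp (beltrami_exponent omega phi z))%C in H.
(* If u_z were 0, the quotient would be 0 by the convention on division, but [Cexp] has no zero. *)
assert (p0 : d_z u z <> 0).
{ intros E; apply (Cexp_neq_0 (beltrami_exponent omega phi z)).
  rewrite <- H, E; C_components; unfold Rdiv; ring. }
split; [exact p0 |].
rewrite <- H; field; exact p0.
Qed.

(* The Wirtinger derivatives of v o u = id along z and zbar are incompatible
   when |mu| = 1. *)
Lemma diffeomorphism_coefficient (M N : C -> Prop) (u : C -> C) (z mu : C) :
  open M -> open N -> diffeomorphism M N u -> M z ->
  d_zbar u z = (mu * d_z u z)%C -> (mu * Cconj mu)%C <> 1.
Proof.
intros oM oN (Hu & MN & v & Hv & _ & vu & _) Mz E Hmu.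
pose proof (smoothC_wirt _ _ _ oM Hu Mz) as Wu.
pose proof (smoothC_wirt _ _ _ oN Hv (MN z Mz)) as Wv.
destruct (wirt_agree M _ _ z _ _ _ _ oM Mz vu (wirt_comp _ _ _ _ _ _ _ Wv Wu) (wirt_id z))
  as [E1 E2].
rewrite E, Cmult_conj in E1; rewrite E in E2.
assert (C1 : (1 : C) <> 0) by (intros H; apply (f_equal Re) in H; simpl in H; lra).
(* If |mu| = 1, then conj(mu) times the left side of [E2] is the left side of [E1], so 1 = 0. *)
apply C1; rewrite <- E1, <- (Cmult_0_r (Cconj mu)), <- E2.
match goal with |- (?a + ?b = Cconj mu * (?c * (mu * ?d) + ?e))%C =>
  transitivity (c * d * (mu * Cconj mu) + Cconj mu * e)%C; [rewrite Hmu|]; ring end.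
Qed.

(** Subtracting conj(mu) times the conjugate equation leaves (1 - |mu|^2) d = 0. *)
Lemma conj_linear_injective (mu d : C) :
  (mu * Cconj mu)%C <> 1 -> (d + Cconj d * Cconj mu = 0)%C -> d = 0.
Proof.
intros Hmu H.
assert (H' := f_equal Cconj H).
rewrite Cplus_conj, Cmult_conj, !Cconj_conj in H'.
replace (Cconj 0) with (0 : C) in H' by (C_components; ring).
assert (K : ((1 - mu * Cconj mu) * d = 0)%C).
{ replace ((1 - mu * Cconj mu) * d)%C
    with ((d + Cconj d * Cconj mu) - Cconj mu * (Cconj d + d * mu))%C by ring.
  rewrite H, H'; ring. }
destruct (Ceq_dec d 0) as [| d0]; trivial.
destruct (Ceq_dec (1 - mu * Cconj mu) 0)%C as [E | E].
- destruct Hmu; replace (mu * Cconj mu)%C with (1 - (1 - mu * Cconj mu))%C by ring.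
  rewrite E; ring.
- now destruct (Cmult_neq_0 _ _ E d0).
Qed.

(** * Derivatives of the log-density along u *)

(** Exchange the derivatives, u_(z zbar) = (u_zbar)_z, and differentiate u_zbar = mu u_z, where mu_z
    = mu sigma_z. *)
Lemma beltrami_d_zbar_d_z (M : C -> Prop) (u : C -> C) (omega phi : C -> R) (z s t : C) :
  open M -> smoothC M u -> beltrami M u omega phi -> M z ->
  wirt (beltrami_exponent omega phi) z s t ->
  d_zbar (d_z u) z =
    (Cexp (beltrami_exponent omega phi z) * (s * d_z u z + d_z (d_z u) z))%C.
Proof.
intros oM Hu Hb Mz Hs.
pose proof (smoothC_wirt _ _ _ oM (smoothC_d_z _ _ oM Hu) Mz) as Wp.
pose proof (smoothC_wirt _ _ _ oM (smoothC_d_zbar _ _ oM Hu) Mz) as Wq.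
destruct (wirt_agree M _ _ z _ _ _ _ oM Mz
  (fun w Mw => proj2 (beltrami_coefficient M u omega phi w Hb Mw)) Wq
  (wirt_mult _ _ _ _ _ _ _ (wirt_Cexp _ _ _ _ Hs) Wp)) as [E _].
rewrite <- (d_z_d_zbar_comm M) by trivial.
rewrite E; ring.
Qed.

(** Here psi_z = i phi_z, so 2 omega - psi has z-derivative - sigma_z. This is where the conjugate
    function enters the choice of the metric. *)
Lemma log_density_d_z (M N : C -> Prop) (u : C -> C) (omega phi psi F : C -> R) (z o f : C) :
  open M -> open N -> diffeomorphism M N u ->
  beltrami M u omega phi -> smoothR N F ->
  (forall w, M w -> F (u w) = 2 * omega w - psi w - ln (norm2 (d_z u w))) ->
  M z ->
  wirt (toC omega) z o (Cconj o) -> wirt (toC phi) z f (Cconj f) ->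
  wirt (toC psi) z (Ci * f)%C (Cconj (Ci * f))%C ->
  (d_z (toC F) (u z) * (d_z u z * d_z u z) =
   - ((- (2) * o + Ci * f) * d_z u z + d_z (d_z u) z))%C.
Proof.
intros oM oN Hd Hb HF E Mz Ho Hf Hpsi.
assert (Hu := proj1 Hd).
destruct (beltrami_coefficient _ _ _ _ _ Hb Mz) as [p0 Eq].
assert (Hmu := diffeomorphism_coefficient _ _ _ _ _ oM oN Hd Mz Eq).
pose proof (beltrami_d_zbar_d_z _ _ _ _ _ _ _ oM Hu Hb Mz
  (wirt_beltrami_exponent _ _ _ _ _ _ _ Ho Hf)) as Epz.
pose proof (smoothC_wirt _ _ _ oM Hu Mz) as Wu.
pose proof (smoothC_wirt _ _ _ oM (smoothC_d_z _ _ oM Hu) Mz) as Wp.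
pose proof (smoothC_wirt _ _ _ oN (smoothC_toC _ _ oN HF) (proj1 (proj2 Hd) z Mz)) as WF.
rewrite (proj2 (wirt_toC_grad _ _ _ _ WF)) in WF.
pose proof (wirt_plus _ _ _ _ _ _ _ (wirt_plus _ _ _ _ _ _ _
  (wirt_scal 2 _ _ _ _ Ho) (wirt_scal (- (1)) _ _ _ _ Hpsi))
  (wirt_scal (- (1)) _ _ _ _ (wirt_ln_norm2 _ _ _ _ p0 Wp))) as WG.
destruct (fun H => wirt_agree M _ _ z _ _ _ _ oM Mz H (wirt_comp _ _ _ _ _ _ _ WF Wu) WG)
  as [EG _].
{ intros w Mw; unfold toC; rewrite E by trivial; C_components; ring. }
rewrite Eq, Epz in EG.
set (p := d_z u z) in *; set (B := d_z (toC F) (u z)) in *.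
set (mu := Cexp (beltrami_exponent omega phi z)) in *.
set (pz := d_z (d_z u) z) in *.
(* [A] is the value to be proved for F_u p. The next identity says p_zbar / p = - mu A, so the term
   conj(p_zbar / p) of (ln |p|^2)_z contributes conj(mu A) to G_z. *)
set (A := (- ((- (2) * o + Ci * f) + pz / p))%C).
assert (EA : (mu * ((- (2) * o + Ci * f) * p + pz) / p = - mu * A)%C).
{ unfold A; field; exact p0. }
rewrite EA in EG.
(* G = F o u has G_z = A + conj mu conj A, while the chain rule gives
   G_z = B p + conj mu conj (B p). *)
assert (D0 : (B * p - A = 0)%C).
{ apply (conj_linear_injective mu); trivial.
  rewrite Cmult_conj, Cmult_conj in EG.
  replace (Cconj (B * p - A)) with (Cconj B * Cconj p - Cconj A)%C by (C_components; ring).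
  replace (Cconj (- mu)) with (- Cconj mu)%C in EG by (C_components; ring).
  match goal with |- ?l = _ => transitivity ((B * p + Cconj B * (Cconj mu * Cconj p)) - (A + Cconj A * Cconj mu))%C; [ring|] end.
  rewrite EG; unfold A; ring. }
replace (B * (p * p))%C with (((B * p - A) + A) * p)%C by ring.
rewrite D0; unfold A; field; exact p0.
Qed.

(** With p = u_z, the left side factors as mu (sigma_z p + p_z + F_u p^2), whose second factor
    vanishes by hypothesis. *)
Lemma log_density_harmonic (M N : C -> Prop) (u : C -> C) (omega phi F : C -> R) (z s t : C) :
  open M -> smoothC M u -> beltrami M u omega phi -> M z ->
  wirt (beltrami_exponent omega phi) z s t ->
  (d_z (toC F) (u z) * (d_z u z * d_z u z) = - (s * d_z u z + d_z (d_z u) z))%C ->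
  (d_z_zbar u z + d_z (toC F) (u z) * d_z u z * d_zbar u z)%C = 0.
Proof.
intros oM Hu Hb Mz Hs EB.
unfold d_z_zbar.
rewrite (beltrami_d_zbar_d_z _ _ _ _ _ _ _ oM Hu Hb Mz Hs).
rewrite (proj2 (beltrami_coefficient _ _ _ _ _ Hb Mz)).
set (mu := Cexp _).
transitivity (mu * ((s * d_z u z + d_z (d_z u) z)
  + d_z (toC F) (u z) * (d_z u z * d_z u z)))%C; [ring |].
rewrite EB; ring.
Qed.

(** The identity for F_u p^2 is assumed on all of M so that it can be differentiated in zbar; the
    z-derivative of p_zbar = - mu F_u p^2 then eliminates p_(z zbar). The F_uu terms cancel because
    u_zbar = mu u_z. *)
Lemma log_density_d_z_zbar (M N : C -> Prop) (u : C -> C) (omega phi F : C -> R) (z : C) :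
  open M -> open N -> smoothC M u -> (forall w, M w -> N (u w)) -> smoothR N F ->
  smoothR M omega -> smoothR M phi -> beltrami M u omega phi ->
  (forall w, M w ->
    (d_z (toC F) (u w) * (d_z u w * d_z u w) =
     - (d_z (beltrami_exponent omega phi) w * d_z u w + d_z (d_z u) w))%C) ->
  M z ->
  (d_z_zbar (toC F) (u z) * RtoC (norm2 (d_z u z)) *
     (1 - RtoC (norm2 (Cexp (beltrami_exponent omega phi z)))) =
   - d_z_zbar (beltrami_exponent omega phi) z)%C.
Proof.
intros oM oN Hu MN HF Ho Hf Hb EB Mz.
set (sg := beltrami_exponent omega phi) in *.
assert (Hsg : smoothC M sg).
{ split.
  (* The summands with 0 and 1 are the components of i phi as the complex product unfolds them, so
     that they match by conversion. *)
  - apply (smoothR_plus M (fun w => -2 * omega w) (fun w => 0 * phi w - 1 * 0)); trivial.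
    + apply smoothR_mult; trivial; now apply smoothR_const.
    + apply smoothR_minus; trivial; [apply smoothR_mult; trivial|]; now apply smoothR_const.
  - apply (smoothR_plus M (fun _ => 0) (fun w => 0 * 0 + 1 * phi w)); trivial.
    + now apply smoothR_const.
    + apply smoothR_plus; trivial; [|apply smoothR_mult; trivial]; now apply smoothR_const. }
assert (Hp := smoothC_d_z _ _ oM Hu).
assert (HFz := smoothC_d_z _ _ oN (smoothC_toC _ _ oN HF)).
pose proof (smoothC_wirt _ _ _ oM Hu Mz) as Wu.
pose proof (smoothC_wirt _ _ _ oM Hp Mz) as Wp.
pose proof (smoothC_wirt _ _ _ oM (smoothC_d_z _ _ oM Hp) Mz) as Wpz.
pose proof (smoothC_wirt _ _ _ oM (smoothC_d_zbar _ _ oM Hp) Mz) as Wpzb.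
pose proof (smoothC_wirt _ _ _ oM Hsg Mz) as Ws.
pose proof (smoothC_wirt _ _ _ oM (smoothC_d_z _ _ oM Hsg) Mz) as Wsz.
pose proof (smoothC_wirt _ _ _ oN HFz (MN z Mz)) as WFz.
assert (WB := wirt_comp _ _ _ _ _ _ _ WFz Wu).
assert (WBpp := wirt_mult _ _ _ _ _ _ _ WB (wirt_mult _ _ _ _ _ _ _ Wp Wp)).
destruct (beltrami_coefficient _ _ _ _ _ Hb Mz) as [p0 Eq].
assert (EB' : forall w, M w ->
  (d_zbar (d_z u) w = - (1) * (Cexp (sg w) * (d_z (toC F) (u w) * (d_z u w * d_z u w))))%C).
{ intros w Mw.
  rewrite EB by trivial.
  rewrite (beltrami_d_zbar_d_z _ _ _ _ _ _ _ oM Hu Hb Mw (smoothC_wirt _ _ _ oM Hsg Mw)).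
  fold sg; ring. }
destruct (wirt_agree M _ _ z _ _ _ _ oM Mz EB' Wpzb
  (wirt_scal _ _ _ _ _ (wirt_mult _ _ _ _ _ _ _ (wirt_Cexp _ _ _ _ Ws) WBpp))) as [E1 _].
destruct (fun H => wirt_agree M _ (fun w => - (1) * (d_z sg w * d_z u w + d_z (d_z u) w))%C
  z _ _ _ _ oM Mz H WBpp
  (wirt_scal _ _ _ _ _ (wirt_plus _ _ _ _ _ _ _ (wirt_mult _ _ _ _ _ _ _ Wsz Wp) Wpz)))
  as [_ E2].
{ intros w Mw; rewrite EB by trivial; ring. }
rewrite <- (d_z_d_zbar_comm M _ z oM Hp Mz), E1 in E2.
assert (EBz := EB z Mz).
rewrite (EB' z Mz) in E2.
rewrite Eq in E2.
fold sg in Eq, E2 |- *.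
rewrite Cmult_conj in E2.
unfold d_z_zbar; rewrite !norm2_Cconj.
set (mu := Cexp (sg z)) in *.
set (K := d_zbar (d_z (toC F)) (u z)) in *.
set (p := d_z u z) in *.
set (B := d_z (toC F) (u z)) in *.
set (Fuu := d_z (d_z (toC F)) (u z)) in *.
set (s := d_z sg z) in *; set (szb := d_zbar (d_z sg) z) in *.
(* Once p_z is eliminated, [E2] is a polynomial relation; the claim times p is its rearrangement,
   and p is cancelled last. *)
assert (Epz : d_z (d_z u) z = (- (s * p + B * (p * p)))%C) by (rewrite EBz; ring).
rewrite Epz in E2.
assert (H : (K * (p * Cconj p) * (1 - mu * Cconj mu) * p = - szb * p)%C).
{ match type of E2 with ?l = ?r => transitivity (- szb * p + (l - r))%C end;
    [ring | rewrite E2; ring]. }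
match goal with |- ?l = _ => transitivity (l * p / p)%C; [field; exact p0 |] end.
rewrite H; field; exact p0.
Qed.

(** * Construction of the metric and evaluation of its curvature *)

Theorem theorem1 :
  forall (M N : C -> Prop) (u : C -> C) (omega phi psi : C -> R),
    plane_domain M -> plane_domain N ->
    diffeomorphism M N u ->
    smoothR M omega -> smoothR M phi ->
    beltrami M u omega phi ->
    (forall z, M z -> d_z_zbar (toC phi) z = RtoC 0) ->
    holomorphic M (fun z => (RtoC (psi z) + Ci * RtoC (phi z))%C) ->
    exists F : C -> R,
      smoothR N F /\
      harmonic_map M F u /\
      forall z, M z ->
        gauss_curvature F (u z) =
        (- (RtoC 2 * d_z_zbar (toC omega) z / RtoC (sinh (2 * omega z)))
           * RtoC (exp (psi z)))%C.
Proof.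
intros M N u omega phi psi [oM _] [oN _] Hd Ho Hf Hb Hharm Hhol.
assert (Hd' := Hd); destruct Hd' as (Hu & MN & v & Hv & NM & vu & uv).
assert (p0 : forall z, M z -> d_z u z <> 0)
  by (intros z Mz; exact (proj1 (beltrami_coefficient _ _ _ _ _ Hb Mz))).
assert (Gpsi : forall z, M z -> grad psi z (py phi z) (- px phi z)).
{ intros z Mz; apply (conjugate_harmonic_grad phi); [exact (Hhol z Mz) |].
  now apply (smoothR_grad M). }
assert (Hpsi : smoothR M psi).
{ destruct (smoothR_partials _ _ Hf).
  apply (smoothR_intro M psi (py phi) (fun z => -1 * px phi z)); trivial.
  - intros z Mz; eapply grad_eq; [exact (Gpsi z Mz) | ring | ring].
  - apply smoothR_mult; trivial; now apply smoothR_const. }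
set (G := fun z => 2 * omega z - psi z - ln (norm2 (d_z u z))).
assert (HG : smoothR M G).
{ destruct (smoothC_d_z _ _ oM Hu) as [P1 P2].
  apply smoothR_minus; [trivial | |].
  - apply smoothR_minus; trivial; apply smoothR_mult; trivial; now apply smoothR_const.
  - apply smoothR_ln; trivial.
    + intros z Mz; apply norm2_pos; auto.
    + apply (smoothR_plus M (fun z => Re (d_z u z) * Re (d_z u z))
        (fun z => Im (d_z u z) * Im (d_z u z))); trivial; now apply smoothR_mult. }
(* The log-density is prescribed on M as [G] and carried to N by the inverse diffeomorphism. *)
set (F := fun w => G (v w)).
assert (HF : smoothR N F) by now apply (smoothR_comp N M G v).
assert (EF : forall z, M z -> F (u z) = G z) by (intros z Mz; unfold F; now rewrite vu).
assert (Ws : forall z, M z -> wirt (beltrami_exponent omega phi) z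
  (- (2) * d_z (toC omega) z + Ci * d_z (toC phi) z)%C
  (- (2) * d_zbar (toC omega) z + Ci * d_zbar (toC phi) z)%C).
{ intros z Mz; apply wirt_beltrami_exponent; apply (smoothC_wirt M); trivial;
    now apply smoothC_toC. }
assert (EB : forall z, M z -> (d_z (toC F) (u z) * (d_z u z * d_z u z) =
   - ((- (2) * d_z (toC omega) z + Ci * d_z (toC phi) z) * d_z u z + d_z (d_z u) z))%C).
{ intros z Mz.
  assert (Gphi := smoothR_grad _ _ _ oM Hf Mz).
  pose proof (smoothC_wirt _ _ _ oM (smoothC_toC _ _ oM Ho) Mz) as Wo.
  rewrite (proj2 (wirt_toC_grad _ _ _ _ Wo)) in Wo.
  pose proof (smoothC_wirt _ _ _ oM (smoothC_toC _ _ oM Hf) Mz) as Wf.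
  rewrite (proj2 (wirt_toC_grad _ _ _ _ Wf)) in Wf.
  apply (log_density_d_z M N u omega phi psi F z); trivial.
  assert (Wpsi := wirt_toC _ _ _ _ (Gpsi z Mz)).
  destruct (wirt_unique _ _ _ _ (wirt_toC _ _ _ _ Gphi)) as [-> _].
  (* Both sides are i phi_z = (phi_y + i phi_x)/2, which is psi_z by the gradient found above. *)
  replace (Ci * _)%C with (py phi z / 2, - - px phi z / 2) by (C_components; field).
  replace (Cconj _) with (py phi z / 2, - px phi z / 2) by (C_components; field).
  exact Wpsi. }
exists F; split; [exact HF | split].
- intros z Mz.
  apply (log_density_harmonic M N u omega phi F z _ _ oM Hu Hb Mz (Ws z Mz)); auto.
- intros z Mz.
  assert (EK := log_density_d_z_zbar M N u omega phi F z oM oN Hu MN HF Ho Hf Hb).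
  (* Harmonicity of phi removes its part of sigma_(z zbar). *)
  assert (Es : d_z_zbar (beltrami_exponent omega phi) z = (- (2) * d_z_zbar (toC omega) z)%C).
  { pose proof (smoothC_wirt _ _ _ oM (smoothC_d_z _ _ oM (smoothC_toC _ _ oM Ho)) Mz) as Wo.
    pose proof (smoothC_wirt _ _ _ oM (smoothC_d_z _ _ oM (smoothC_toC _ _ oM Hf)) Mz) as Wf.
    pose proof (wirt_plus _ _ _ _ _ _ _ (wirt_scal (- (2)) _ _ _ _ Wo)
      (wirt_scal Ci _ _ _ _ Wf)) as W.
    apply (wirt_ext_open M _ (d_z (beltrami_exponent omega phi))) in W; trivial;
      [| intros w Mw; symmetry; exact (proj1 (wirt_unique _ _ _ _ (Ws w Mw)))].
    unfold d_z_zbar at 1; rewrite (proj2 (wirt_unique _ _ _ _ W)).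
    specialize (Hharm z Mz); unfold d_z_zbar in *; rewrite Hharm; ring. }
  rewrite Es in EK.
  specialize (EK ltac:(intros w Mw; rewrite (proj1 (wirt_unique _ _ _ _ (Ws w Mw))); auto) Mz).
  destruct (beltrami_coefficient _ _ _ _ _ Hb Mz) as [_ Eq].
  assert (Hmu := diffeomorphism_coefficient _ _ _ _ _ oM oN Hd Mz Eq).
  rewrite <- norm2_Cconj in Hmu.
  unfold gauss_curvature; rewrite EF by trivial.
  (* In terms of x, |mu|^2 = 1/x^2, sinh(2 omega) = (x - 1/x)/2 and e^(-F) at u(z) is e^psi |p|^2 /
     x, so the curvature formula becomes a rational identity. *)
  set (x := exp (2 * omega z)).
  assert (x0 : x <> 0) by apply Rgt_not_eq, exp_pos.
  assert (En : norm2 (Cexp (beltrami_exponent omega phi z)) = / x * / x).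
  { rewrite norm2_Cexp; unfold x; rewrite <- exp_Ropp, <- exp_plus.
    f_equal; unfold beltrami_exponent, Re, Im; simpl; ring. }
  assert (ED : exp (- G z) = / x * exp (psi z) * norm2 (d_z u z)).
  { rewrite <- (exp_ln (norm2 (d_z u z))) by now apply norm2_pos, p0.
    unfold x, G; rewrite <- exp_Ropp, <- !exp_plus; f_equal; ring. }
  assert (Esh : sinh (2 * omega z) = (x - / x) / 2)
    by (unfold sinh, x; now rewrite exp_Ropp).
  rewrite En in EK, Hmu; rewrite ED, Esh.
  (* From |mu| <> 1; hence sinh(2 omega) <> 0 and the division in the formula is genuine. *)
  assert (x1 : x * x - 1 <> 0).
  { intros H; apply Hmu; f_equal.
    replace (/ x * / x) with (/ (x * x)) by (field; exact x0).
    replace (x * x) with 1 by lra; field. }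
  (* 2 omega_(z zbar) is traded for F_(u ubar) |p|^2 (1 - |mu|^2), after which F_(u ubar) occurs on
     both sides. *)
  replace (RtoC 2 * d_z_zbar (toC omega) z)%C with (- (- (2) * d_z_zbar (toC omega) z))%C by ring.
  rewrite <- EK.
  rewrite !RtoC_mult, (RtoC_div (x - / x)), RtoC_minus, RtoC_inv by (trivial; lra).
  field; split; intros H; apply (f_equal Re) in H; simpl in H; lra.
Qed.
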